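(* Let $f\in\mathcal T_{\pm}$. The set $$Y_f^p:=\{y\in\mathbb R: L_f(y)\text{ is a perfect set (hence uncountable)}\}$$ is residual in the range of $f$.
   Context: Let $\phi(x)=\operatorname{dist}(x,\mathbb Z)$ denote the distance from $x\in\mathbb R$ to the nearest integer. $\mathcal T_{\pm}$ is the collection of all functions (signed Takagi functions) of the form $f(x)=\sum_{n=0}^\infty \frac{r_n}{2^n}\phi(2^nx)$ with $r_n\in\{-1,1\}$ for every $n\ge0$. For $y\in\mathbb R$, $L_f(y):=\{x\in[0,1]:f(x)=y\}$. A set is perfect if it is (nonempty) closed and has no isolated points. The range of $f$ is the compact interval $f([0,1])$; a set $Y$ is residual in the range of $f$ if $f([0,1])\setminus Y$ is of first Baire category (meager) in $f([0,1])$. *)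

(* Defs.v *)
From mathcomp Require Import all_boot all_order all_algebra.
From mathcomp Require Import all_classical all_reals all_analysis.
Import Order.TTheory GRing.Theory Num.Theory.
Import numFieldNormedType.Exports.

Set Implicit Arguments.
Unset Strict Implicit.
Unset Printing Implicit Defensive.

Local Open Scope classical_set_scope.
Local Open Scope ring_scope.

Section takagi.
Variable R : realType.

Definition dist_int (x : R) : R := inf [set `|x - k%:~R| | k in [set: int]].

Definition signed_takagi : set (R -> R) :=
  [set f | exists2 r : nat -> R, (forall n, r n = -1 \/ r n = 1) &
    forall x, f x = limn (series (fun n => r n / 2 ^+ n * dist_int (2 ^+ n * x)))].

Definition level_set (f : R -> R) (y : R) : set R :=
  [set x | `[0, 1]%classic x /\ f x = y].

(* The library's [perfect_set] does not exclude the empty set. *)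
Definition perfect_levels (f : R -> R) : set R :=
  [set y | level_set f y !=set0 /\ perfect_set (level_set f y)].

Definition takagi_range (f : R -> R) : set R := f @` `[0, 1]%classic.

End takagi.

Definition nowhere_dense (T : topologicalType) (B : set T) : Prop :=
  (closure B)^° = set0.

Definition meager (T : topologicalType) (B : set T) : Prop :=
  exists2 F : nat -> set T,
    (forall n, nowhere_dense (F n)) & B = \bigcup_n F n.

(* Meagerness is relative to [A]: the coercion of [A] to a type carries the
   subspace topology. *)
Definition residual_in (T : topologicalType) (A Y : set T) : Prop :=
  meager [set a : A | ~ Y (set_val a)].

(* Main.v *)
Require Import Defs.
From mathcomp Require Import all_boot all_order all_algebra.
From mathcomp Require Import all_classical all_reals all_analysis.
From mathcomp Require Import ring lra zify.
Import Order.TTheory GRing.Theory Num.Theory.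
Import numFieldNormedType.Exports.

Local Open Scope classical_set_scope.
Local Open Scope ring_scope.

(** The level sets of a continuous function [f] are closed, so the level of a
    value [y] in the range fails to be perfect exactly when it has an isolated
    point, that is, when some ball of rational centre and radius contains one
    and only one point of it.  There are countably many such balls, so it
    suffices that for each ball the set of values taken exactly once in it is
    nowhere dense ([unique_in_ball_nowhere_dense]).

    For this, [f] need only return near every point of [[0, 1]]: arbitrarily
    close to it there are [a < b < c] with [f a = f c] and [f b != f a].  By the
    intermediate value theorem every value strictly between [f a] and [f b] is
    taken in [[a, b]] and again in [[b, c]].  Hence, close to any value taken
    exactly once in the ball, there is an open interval of values taken at least
    twice in it.

    A signed Takagi function returns near every point ([takagi_returns]).  Over
    a dyadic interval of length [2 ^- n] its chord has an integer slope, and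
    the two halves have slopes [s + e] and [s - e], where [s] is the slope of
    the whole and [e] is the [n]-th sign.  Always passing to the half whose slope
    is smaller in absolute value, one reaches a dyadic interval of slope zero;
    the function is equal at its two ends and different at its midpoint.

    Finally, a nonempty perfect level set is compact, hence uncountable by the
    usual argument with nested neighbourhoods
    ([perfect_compact_uncountable]). *)

(** * Compact perfect sets are uncountable *)

(** A nested sequence of closed neighbourhoods, the n-th one avoiding the n-th
    term of an enumeration, shrinks to a point of the set that was missed. *)
Lemma perfect_compact_uncountable (T : topologicalType) (L : set T) :
  regular_space T -> hausdorff_space T ->
  compact L -> L !=set0 -> perfect_set L -> ~ countable L.
Proof.
move=> regT hT cL L0 [_ limL] /pfcard_geP[Le|[e]]; first by case: L0; rewrite Le.
have sube : L `<=` range e.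
  by move=> x /(@surj _ _ _ _ e)[n _ <-]; exists n.
(* A neighbourhood meeting [L] can be shrunk so that its closure misses [e n]
   and its interior still meets [L]: as the points of [L] are limit points,
   one can move away from [e n]. *)
have step (nV : nat * set T) : exists V',
    L `&` nV.2° !=set0 ->
    [/\ L `&` V'° !=set0, closure V' `<=` nV.2 & ~ closure V' (e nV.1)].
  case: nV => n V /=; have [[c [Lc Vc]]|?] := pselect (L `&` V° !=set0);
    last by exists V.
  have [d [Ld Vd dn]] : exists d, [/\ L d, V° d & d != e n].
    have [cn|cn] := eqVneq c (e n); last by exists c.
    have : limit_point L c by rewrite limL.
    move/(_ V°) => -[|d [dc Ld Vd]]; first exact: nbhs_interior.
    by exists d; rewrite -cn.
  have : nbhs d (V `&` ~` [set e n]).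
    apply: filterI => //; apply: open_nbhs_nbhs; split.
      by apply: closed_openC; apply: accessible_closed_set1; exact: hausdorff_accessible.
    exact/eqP.
  move=> /(regT d)[U dU clU]; exists U => _; split.
  - by exists d.
  - by move=> x /clU[].
  - by move=> /clU[_] /=.
have [g gP] := choice step.
pose s := fix s n := if n is n'.+1 then g (n', s n') else setT.
have sL n : L `&` (s n)° !=set0.
  elim: n => [|n IH]; last by have [] := gP (n, s n) IH.
  by case: L0 => x Lx; exists x; split => //=; rewrite interiorT.
have sS n : closure (s n.+1) `<=` s n by have [] := gP (n, s n) (sL n).
have sE n : ~ closure (s n.+1) (e n) by have [] := gP (n, s n) (sL n).
have sm n m : (n <= m)%N -> s m `<=` s n.
  elim: m => [|m IH]; first by rewrite leqn0 => /eqP->.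
  rewrite leq_eqVlt => /predU1P[->//|/IH h] x /(@subset_closure _ _)/(sS m).
  exact: h.
have [c cP] := choice sL.
(* A cluster point of the chosen points lies in every closure. *)
have [|x [Lx xc]] := cL (c @ \oo) _.
  by exists 0%N => // n _; have [] := cP n.
have [n _ en] := sube _ Lx.
apply: (sE n); rewrite en => U xU; apply: xc => //.
exists n.+1 => // m /= nm; apply: (sm _ _ nm).
by have [_ /interior_subset] := cP m.
Qed.

(** * The distance to the nearest integer *)

Section DistInt.
Variable R : realType.
Implicit Types (x y : R) (k : int).

Lemma dist_int_le x k : dist_int x <= `|x - k%:~R|.
Proof.
apply: ge_inf; last by exists k.
by exists 0 => _ [m _ <-].
Qed.

Lemma le_dist_int x c : (forall k, c <= `|x - k%:~R|) -> c <= dist_int x.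
Proof.
move=> h; apply: lb_le_inf; first by exists `|x - 0%:~R|, 0.
by move=> _ [m _ <-].
Qed.

Lemma dist_int_ge0 x : 0 <= dist_int x.
Proof. exact: le_dist_int. Qed.

Lemma dist_int_near x k : `|x - k%:~R| <= 2^-1 -> dist_int x = `|x - k%:~R|.
Proof.
move=> xk; apply/eqP; rewrite eq_le dist_int_le /=; apply: le_dist_int => m.
have [->//|mk] := eqVneq m k.
have : 1 <= `|m - k|%:~R :> R by rewrite ler1z; lia.
rewrite intr_norm intrD mulrNz => h.
have := ler_distD x (m%:~R : R) k%:~R; rewrite (distrC _ x); lra.
Qed.

Lemma dist_int_le_half x : dist_int x <= 2^-1.
Proof.
have /andP[h1 h2] := floor_itv x.
have := dist_int_le x (Num.floor x); have := dist_int_le x (Num.floor x + 1).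
rewrite (ger0_norm (x := x - (Num.floor x)%:~R)) ?subr_ge0//.
rewrite ltr0_norm ?subr_lt0// intrD; lra.
Qed.

Lemma dist_int_int k : dist_int (k%:~R : R) = 0.
Proof. by rewrite (dist_int_near _ k) ?subrr ?normr0 ?invr_ge0. Qed.

Lemma dist_int_half k : dist_int (k%:~R + 2^-1 : R) = 2^-1.
Proof.
have h : `|k%:~R + 2^-1 - k%:~R| = 2^-1 :> R.
  by rewrite addrAC subrr add0r ger0_norm// invr_ge0.
by rewrite (dist_int_near _ k) h.
Qed.

Lemma dist_int_lipschitz x y : dist_int x - dist_int y <= `|x - y|.
Proof.
rewrite lerBlDr -lerBlDl; apply: le_dist_int => k.
have := dist_int_le x k; have := ler_distD y x k%:~R; lra.
Qed.

Lemma dist_int_continuous : continuous (@dist_int R).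
Proof.
move=> x; apply/cvgrPdist_lt => e e0; near=> y.
have xy : `|x - y| < e by near: y; exact: cvgr_dist_lt.
apply: le_lt_trans xy; rewrite ler_norml.
have := dist_int_lipschitz x y; have := dist_int_lipschitz y x.
rewrite (distrC y); lra.
Unshelve. all: by end_near. Qed.

(** The distance to the integers is affine on each half-unit cell. *)
Lemma dist_int_affine (h : int) : exists a c : R, forall x,
  h%:~R / 2 <= x <= (h + 1)%:~R / 2 -> dist_int x = a * x + c.
Proof.
have h2 : h = (h %/ 2)%Z * 2 + (h %% 2)%Z := divz_eq h 2.
set p := (h %/ 2)%Z in h2.
have [h0|h1] : (h %% 2)%Z = 0 \/ (h %% 2)%Z = 1 by lia.
- exists 1, (- p%:~R) => x.
  rewrite h2 h0 addr0 !intrD intrM => xh.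
  have := dist_int_near x p; rewrite ger0_norm; lra.
- exists (- 1), (p + 1)%:~R => x.
  rewrite h2 h1 !intrD intrM => xh.
  have := dist_int_near x (p + 1); rewrite !intrD ler0_norm; lra.
Qed.

(** The interval from [k / 2 ^ j.+1] to [(k + 1) / 2 ^ j.+1] lies in a single
    half-unit cell, so the value at its midpoint is the mean of the values at
    its ends. *)
Lemma dist_int_midpoint (j : nat) k :
  2 * dist_int ((2 * k + 1)%:~R / 2 ^+ j.+2 : R) =
  dist_int (k%:~R / 2 ^+ j.+1 : R) + dist_int ((k + 1)%:~R / 2 ^+ j.+1 : R).
Proof.
(* The half-unit cell containing the interval starts at [h / 2]. *)
pose h := (k %/ 2%:Z ^+ j)%Z.
have P0 : (0 < 2%:Z ^+ j) by exact: exprn_gt0.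
have hk1 : h * 2%:Z ^+ j <= k by rewrite lez_floor ?gt_eqF.
have hk2 : k + 1 <= (h + 1) * 2%:Z ^+ j by rewrite lezD1 ltz_ceil.
have [a [c ac]] := dist_int_affine h.
have Q0 : (0 : R) < 2 ^+ j by exact: exprn_gt0.
have E : (2 ^+ j : R) = (2%:Z ^+ j)%:~R by rewrite rmorphXn.
move: hk1 hk2; rewrite -!(ler_int R) !intrM -E => hk1 hk2.
have E1 : (k%:~R / 2 ^+ j.+1 : R) = k%:~R / 2 ^+ j / 2.
  by rewrite exprS; field; rewrite gt_eqF.
have E2 : ((k + 1)%:~R / 2 ^+ j.+1 : R) = (k + 1)%:~R / 2 ^+ j / 2.
  by rewrite exprS; field; rewrite gt_eqF.
have E3 : ((2 * k + 1)%:~R / 2 ^+ j.+2 : R) =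
    (k%:~R / 2 ^+ j / 2 + (k + 1)%:~R / 2 ^+ j / 2) / 2.
  by rewrite !exprS !intrD intrM; field; rewrite gt_eqF.
have I1 : h%:~R <= k%:~R / 2 ^+ j :> R by rewrite ler_pdivlMr.
have I2 : (k + 1)%:~R / 2 ^+ j <= (h + 1)%:~R :> R by rewrite ler_pdivrMr.
have I3 : k%:~R / 2 ^+ j <= (k + 1)%:~R / 2 ^+ j :> R.
  by rewrite ler_pM2r ?invr_gt0// ler_int; lia.
rewrite E3 E1 E2; set u := _ / 2 ^+ j in I1 I3 *; set v := _ / 2 ^+ j in I2 I3 *.
rewrite (ac (u / 2)) ?(ac (v / 2)) ?(ac ((u / 2 + v / 2) / 2)); lra.
Qed.

End DistInt.

(** * Signed Takagi functions and their dyadic chords *)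

Section SignedTakagi.
Variables (R : realType) (r : nat -> R).
Hypothesis r_sign : forall n, r n = -1 \/ r n = 1.
Implicit Types (x y e : R) (k l s : int) (n m : nat).

(** The [n]-th term of the series at [x]. *)
Definition takagi_term x n : R := r n / 2 ^+ n * dist_int (2 ^+ n * x).

(** The signed Takagi function with sign sequence [r]; the series converges at
    every [x] by [is_cvg_takagi]. *)
Definition takagi x : R := limn (series (takagi_term x)).

Lemma norm_sign n : `|r n| = 1.
Proof. by case: (r_sign n) => ->; rewrite ?normrN normr1. Qed.

Lemma norm_takagi_term x n : `|takagi_term x n| <= 2^-1 / 2 ^+ n.
Proof.
rewrite /takagi_term !normrM norm_sign mul1r normfV (ger0_norm (exprn_ge0 _ _))//.
rewrite mulrC ler_pM2r ?invr_gt0 ?exprn_gt0//.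
by rewrite ger0_norm ?dist_int_ge0 ?dist_int_le_half.
Qed.

Lemma takagi_series_tail x n m : (n <= m)%N ->
  `|series (takagi_term x) m - series (takagi_term x) n| <= (2 ^+ n)^-1.
Proof.
move=> /subnKC <-; set j := (m - n)%N.
(* The induction needs the sharper bound [2 ^- n - 2 ^- m]. *)
suff : `|series (takagi_term x) (n + j)%N - series (takagi_term x) n| <=
    (2 ^+ n)^-1 - (2 ^+ (n + j)%N)^-1.
  by move=> /le_trans; apply; rewrite gerBl invr_ge0 exprn_ge0.
elim: j => [|j IH]; first by rewrite addn0 !subrr ?normr0.
rewrite addnS /series/= big_nat_recr//= -/(series _ _) addrAC.
have -> : (2 ^+ n)^-1 - (2 ^+ (n + j).+1%N)^-1 =
  ((2 ^+ n)^-1 - (2 ^+ (n + j)%N)^-1) + 2^-1 / 2 ^+ (n + j)%N :> R.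
  by rewrite !exprS; field; rewrite ?expf_neq0.
by apply: le_trans (ler_normD _ _) _; rewrite lerD// norm_takagi_term.
Qed.

Lemma half_powers_small e : 0 < e -> exists n, (2 ^+ n)^-1 < e.
Proof.
move=> e0; exists (Num.bound e^-1).
by rewrite invf_plt ?posrE ?exprn_gt0// upper_nthrootP.
Qed.

Lemma is_cvg_takagi x : cvgn (series (takagi_term x)).
Proof.
apply/cauchy_cvgP/cauchy_exP => e e0.
have [n ne] := half_powers_small _ e0.
exists (series (takagi_term x) n); exists n => // m /= nm.
rewrite /ball/= distrC; exact: le_lt_trans (takagi_series_tail _ _ _ nm) ne.
Qed.

Lemma takagi_tail x n : `|takagi x - series (takagi_term x) n| <= (2 ^+ n)^-1.
Proof.
have h m : (n <= m)%N -> series (takagi_term x) n - (2 ^+ n)^-1 <=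
    series (takagi_term x) m <= series (takagi_term x) n + (2 ^+ n)^-1.
  by move=> /(takagi_series_tail x); rewrite ler_distl.
rewrite ler_distl; apply/andP; split.
- by apply: limr_ge; [exact: is_cvg_takagi | exists n => // m /= /h /andP[]].
- by apply: limr_le; [exact: is_cvg_takagi | exists n => // m /= /h /andP[]].
Qed.

Lemma takagi_series_continuous n : continuous (fun x => series (takagi_term x) n).
Proof.
elim: n => [|n IH].
  have -> : (fun x => series (takagi_term x) 0) = cst 0.
    by apply/funext => x; rewrite /series/= big_geq.
  by move=> x; exact: cvg_cst.
have -> : (fun x => series (takagi_term x) n.+1) =
    (fun x => series (takagi_term x) n + takagi_term x n).
  by apply/funext => x; rewrite /series/= big_nat_recr.
move=> x; apply: cvgD; first exact: IH.
apply: cvgM; first exact: cvg_cst.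
apply: (@continuous_comp _ _ _ (fun y => 2 ^+ n * y) (@dist_int R)).
  exact: mulrl_continuous.
exact: dist_int_continuous.
Qed.

Lemma takagi_continuous : continuous takagi.
Proof.
move=> x; apply/cvgrPdist_lt => e e0.
have e4 : 0 < e / 4 by lra.
have [n ne] := half_powers_small _ e4.
near=> y.
have h : `|series (takagi_term x) n - series (takagi_term y) n| < e / 4.
  by near: y; apply: cvgr_dist_lt => //; exact: takagi_series_continuous.
have := takagi_tail x n; have := takagi_tail y n; move: h.
rewrite ltr_distl !ler_distl ltr_distl.
move: (series _ _) (series _ _) => u v; lra.
Unshelve. all: by end_near. Qed.

(** The dyadic rational [k / 2 ^ n]. *)
Definition dyadic n k : R := k%:~R / 2 ^+ n.

Lemma dyadic_double n k : dyadic n.+1 (2 * k) = dyadic n k.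
Proof. by rewrite /dyadic exprS intrM; field; rewrite expf_neq0. Qed.

Lemma exp2n_gt0 n : 0 < 2 ^+ n :> R.
Proof. exact: exprn_gt0. Qed.

Lemma ler_dyadic n k l : (dyadic n k <= dyadic n l) = (k <= l).
Proof. by rewrite /dyadic ler_pM2r ?invr_gt0 ?exp2n_gt0// ler_int. Qed.

Lemma ltr_dyadic n k l : (dyadic n k < dyadic n l) = (k < l).
Proof. by rewrite /dyadic ltr_pM2r ?invr_gt0 ?exp2n_gt0// ltr_int. Qed.

Lemma takagi_term_dyadic n k m : (n <= m)%N -> takagi_term (dyadic n k) m = 0.
Proof.
move=> /subnK <-; rewrite /takagi_term /dyadic exprD.
have -> : 2 ^+ (m - n) * 2 ^+ n * (k%:~R / 2 ^+ n) = (2 ^+ (m - n) * k)%:~R :> R.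
  by rewrite intrM rmorphXn/=; field; rewrite expf_neq0.
by rewrite dist_int_int mulr0.
Qed.

(** At [k / 2 ^ n] the terms of index at least [n] vanish, so the series is a
    finite sum. *)
Lemma takagi_dyadic n k :
  takagi (dyadic n k) = \sum_(i < n) takagi_term (dyadic n k) i.
Proof.
apply: norm_lim_near_cst; exists n => // m /= nm.
rewrite /series/= (big_cat_nat (n := n))//= big_mkord [X in _ + X]big1_seq ?addr0//.
by move=> i /=; rewrite mem_index_iota => /andP[ni _]; exact: takagi_term_dyadic.
Qed.

(** The terms of index less than [n] are affine on the dyadic interval, and the
    [n]-th one vanishes at its ends and not at its midpoint. *)
Lemma takagi_midpoint n k : 2 * takagi (dyadic n.+1 (2 * k + 1)) =
  takagi (dyadic n k) + takagi (dyadic n (k + 1)) + r n / 2 ^+ n.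
Proof.
rewrite !takagi_dyadic big_ord_recr/= mulrDr; congr (_ + _).
  rewrite mulr_sumr -big_split/=; apply: eq_bigr => -[i ni] _ /=.
  have -> : n = (i + (n - i.+1).+1)%N by lia.
  set j := (n - i.+1)%N; rewrite /takagi_term /dyadic.
  have sc h q : 2 ^+ i * (h / 2 ^+ (i + q)) = h / 2 ^+ q :> R.
    by rewrite exprD; field; rewrite !expf_neq0.
  by rewrite -addnS !sc mulrCA dist_int_midpoint mulrDr.
have -> : takagi_term (dyadic n.+1 (2 * k + 1)) n = r n / 2 ^+ n * 2^-1.
  rewrite /takagi_term -(dist_int_half R k); congr (_ * dist_int _).
  by rewrite /dyadic exprS intrD intrM; field; rewrite expf_neq0.
by field; rewrite expf_neq0.
Qed.

(** The chord of the function over [[k / 2 ^ n, (k + 1) / 2 ^ n]] has slope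
    [s], an integer. *)
Definition chord_slope n k s :=
  takagi (dyadic n (k + 1)) - takagi (dyadic n k) = s%:~R / 2 ^+ n.

(** Halving a dyadic interval of slope [s] yields slopes [s + 1] and [s - 1],
    in the order given by the sign. *)
Lemma chord_slope_halves n k s : chord_slope n k s -> exists e : int,
  [/\ e = 1 \/ e = -1, chord_slope n.+1 (2 * k) (s + e)
    & chord_slope n.+1 (2 * k + 1) (s - e)].
Proof.
move=> sE; have [e [e1 re]] : exists e : int, (e = 1 \/ e = -1) /\ r n = e%:~R.
  by case: (r_sign n) => ->; [exists (-1) | exists 1]; split; auto.
have right_end : dyadic n.+1 (2 * k + 1 + 1) = dyadic n (k + 1).
  by rewrite -(dyadic_double n (k + 1)); congr dyadic; lia.
exists e; split => //; have := takagi_midpoint n k; move: sE;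
  rewrite /chord_slope ?right_end ?dyadic_double re exprS invfM;
  rewrite intrD ?mulrNz; lra.
Qed.

Lemma exists_chord_slope n k : exists s, chord_slope n k s.
Proof.
elim: n k => [|n IH] k.
  by exists 0; rewrite /chord_slope !takagi_dyadic !big_ord0 subrr mul0r.
have [s /chord_slope_halves[e [_ sl sr]]] := IH (k %/ 2)%Z.
have [->|->] : k = 2 * (k %/ 2)%Z \/ k = 2 * (k %/ 2)%Z + 1 by lia.
- by exists (s + e).
- by exists (s - e).
Qed.

(** One of the two slopes [s + 1] and [s - 1] is smaller than [s] in absolute
    value, so descending to that half finally reaches slope zero. *)
Lemma zero_slope_inside n k s : chord_slope n k s -> exists m l,
  [/\ chord_slope m l 0, dyadic n k <= dyadic m l
    & dyadic m (l + 1) <= dyadic n (k + 1)].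
Proof.
have [N] := ubnP `|s|%N; elim: N n k s => // N IH n k s sN sE.
have [s0|s0] := eqVneq s 0; first by exists n, k; split; rewrite -?s0.
have [e [e1 sl sr]] := chord_slope_halves n k s sE.
have [s' [k' [s'N s'E k1 k2]]] : exists s' k',
    [/\ (`|s'| < N)%N, chord_slope n.+1 k' s', 2 * k <= k' & k' + 1 <= 2 * (k + 1)].
  have [h|h] : (`|(s + e)%R| < N)%N \/ (`|(s - e)%R| < N)%N by lia.
  - by exists (s + e), (2 * k); split => //; lia.
  - by exists (s - e), (2 * k + 1); split => //; lia.
have [m [l [ml h1 h2]]] := IH _ _ _ s'N s'E; exists m, l; split => //.
- by apply: le_trans h1; rewrite -dyadic_double ler_dyadic.
- by apply: le_trans h2 _; rewrite -(dyadic_double n) ler_dyadic.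
Qed.

(** Inside every dyadic interval the function returns to a value after having
    left it. *)
Lemma takagi_returns_dyadic n k : exists x y z,
  [/\ dyadic n k <= x, x < y, y < z, z <= dyadic n (k + 1) &
      takagi x = takagi z /\ takagi y != takagi x].
Proof.
have [s /zero_slope_inside[m [l [ml h1 h2]]]] := exists_chord_slope n k.
exists (dyadic m l), (dyadic m.+1 (2 * l + 1)), (dyadic m (l + 1)).
have lz : takagi (dyadic m l) = takagi (dyadic m (l + 1)).
  by apply/esym/eqP; rewrite -subr_eq0 ml mul0r.
split => //; rewrite -?(dyadic_double m) ?ltr_dyadic; try lia.
rewrite !dyadic_double; split => //; apply/eqP => h.
have := takagi_midpoint m l; rewrite h -lz => /eqP.
have -> : 2 * takagi (dyadic m l) = takagi (dyadic m l) + takagi (dyadic m l) by ring.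
rewrite eq_sym addrC -subr_eq0 addrK mulf_eq0 invr_eq0 expf_eq0 pnatr_eq0 andbF orbF.
by rewrite -normr_eq0 norm_sign oner_eq0.
Qed.

End SignedTakagi.

(** * Returning functions *)

(** [f] returns near [x]: arbitrarily close to [x] within the unit interval it
    takes equal values at two points and a different value between them. *)
Definition returns_near (R : realType) (f : R -> R) (x : R) := forall e : R, 0 < e ->
  exists a b c, [/\ [/\ 0 <= a, a < b, b < c & c <= 1],
    (`|a - x| < e /\ `|c - x| < e), f a = f c & f b != f a].

Lemma takagi_returns (R : realType) (r : nat -> R) (x : R) :
  (forall n, r n = -1 \/ r n = 1) -> 0 <= x <= 1 -> returns_near R (takagi R r) x.
Proof.
move=> r_sign /andP[x0 x1] e e0.
have [n ne] := half_powers_small _ e e0.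
have P : 0 < 2 ^+ n :> R by exact: exprn_gt0.
have [k [k0 kn xk]] : exists k : int, [/\ 0 <= k, k + 1 <= 2 ^+ n &
    k%:~R <= x * 2 ^+ n <= (k + 1)%:~R].
  have E : (2 ^+ n : R) = (2%:Z ^+ n)%:~R by rewrite rmorphXn.
  (* Rounding down [2 ^ n * x] would put [1] outside the unit interval, so this
     point is placed at the right end of the last cell. *)
  have [->|x1'] := eqVneq x 1.
    exists (2 ^+ n - 1); rewrite subrK subr_ge0 mul1r E; split => //.
      by rewrite -gtz0_ge1 exprn_gt0.
    by rewrite !ler_int; move: (2 ^+ n) => u; lia.
  have /andP[h1 h2] := floor_itv (x * 2 ^+ n).
  exists (Num.floor (x * 2 ^+ n)); split; last by rewrite h1 ltW.
    by rewrite floor_ge0 mulr_ge0// ltW.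
  rewrite lezD1 floor_lt_int -E gtr_pMl// lt_neqAle x1' x1 //.
have [a [b [c [ka ab bc ck [fac fba]]]]] := takagi_returns_dyadic R r r_sign n k.
have k0' : 0 <= dyadic R n k by rewrite divr_ge0 ?ler0z// ltW.
have k1' : dyadic R n (k + 1) <= 1.
  rewrite /dyadic ler_pdivrMr// mul1r.
  have -> : (2 ^+ n : R) = (2%:Z ^+ n)%:~R by rewrite rmorphXn.
  by rewrite ler_int.
have kk : dyadic R n (k + 1) = dyadic R n k + (2 ^+ n)^-1.
  by rewrite /dyadic intrD mulrDl mul1r.
have : dyadic R n k <= x <= dyadic R n (k + 1).
  by rewrite /dyadic ler_pdivrMr// ler_pdivlMr.
move=> /andP[kx xk'].
exists a, b, c; split => //; first by split => //; lra.
rewrite !ltr_distl; split; apply/andP; split; lra.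
Qed.

(** * Level sets of continuous returning functions *)

Lemma rational_ball (R : realType) (x : R) (A : set R) : nbhs x A ->
  exists p q : rat, ball (ratr p : R) (ratr q) x /\ ball (ratr p : R) (ratr q) `<=` A.
Proof.
move=> /nbhs_ballP[e /= e0 eA].
have [|q] := @rat_in_itvoo R 0 (e / 2); first lra.
rewrite in_itv/= => /andP[q0 qe].
have [|p] := @rat_in_itvoo R (x - ratr q) (x + ratr q); first lra.
rewrite in_itv/= => pq; exists p, q; rewrite /ball/=; split.
  by rewrite ltr_distl; lra.
move=> y; rewrite /= ltr_distl => yp; apply: eA; rewrite /ball/= ltr_distl; lra.
Qed.

Section LevelSets.
Variables (R : realType) (f : R -> R).
Hypothesis f_cont : continuous f.
Implicit Types (x y p q : R).

Lemma IVT_continuous (a b v : R) : a <= b ->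
  Num.min (f a) (f b) <= v <= Num.max (f a) (f b) -> exists2 c, a <= c <= b & f c = v.
Proof.
move=> ab vab; have [|c cab fc] := IVT ab _ vab.
  by apply: continuous_subspaceT => ? ?; exact: f_cont.
by exists c; rewrite -?(itvP cab) //; move: cab; rewrite in_itv.
Qed.

Lemma level_set_closed y : closed (level_set f y).
Proof.
have -> : level_set f y = `[0, 1]%classic `&` f @^-1` [set y] by [].
apply: closedI; first exact: interval_closed.
apply: preimage_closed => [? ?|]; [exact: f_cont|exact: closed_eq].
Qed.

Lemma level_set_compact y : compact (level_set f y).
Proof.
apply: (subclosed_compact _ (@segment_compact R 0 1)).
- exact: level_set_closed.
- by move=> x [].
Qed.

(** The values of the range attained exactly once in [[0, 1]] inside the ball
    of centre [p] and radius [q]. *)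
Definition unique_in_ball p q : set (takagi_range f) :=
  [set y | exists x, level_set f (set_val y) `&` ball p q = [set x]].

(** Close to a point where a value is taken only once there are [a < b < c] with
    [f a = f c] and [f b != f a].  The values strictly between [f a] and [f b]
    form an open set, and each is taken before [b] and again after it. *)
Lemma unique_in_ball_nowhere_dense p q :
  (forall x, 0 <= x <= 1 -> returns_near R f x) ->
  nowhere_dense (unique_in_ball p q).
Proof.
move=> ret; apply/seteqP; split => // t.
rewrite /interior nbhsE => -[U [[W oW WU] Ut] Ucl].
have [y [[x0 x0E] Wy]] : unique_in_ball p q `&` U !=set0.
  by apply: (Ucl t Ut); apply: open_nbhs_nbhs; split => //; exists W.
have [[x01 fx0] bx0] : (level_set f (set_val y) `&` ball p q) x0 by rewrite x0E.
have : nbhs x0 (f @^-1` W `&` ball p q).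
  apply: filterI; last first.
    by apply: open_nbhs_nbhs; split => //; exact: ball_open.
  apply: f_cont; apply: open_nbhs_nbhs; split => //.
  by rewrite fx0; move: Wy; rewrite -WU.
move=> /nbhs_ballP[e /= e0 eW].
have [|a [b [c [[a0 ab bc c1] [ax cx] fac fba]]]] := ret x0 _ e e0.
  by move: x01; rewrite /= in_itv.
pose V := [set v | Num.min (f a) (f b) < v < Num.max (f a) (f b)].
have oV : open V.
  have -> : V = `]Num.min (f a) (f b), Num.max (f a) (f b)[%classic.
    by apply/seteqP; split => v /=; rewrite in_itv.
  exact: interval_open.
have twice v : V v -> exists x1 x2, [/\ x1 != x2, f x1 = v /\ f x2 = v,
    ball x0 e x1 /\ ball x0 e x2 & 0 <= x1 <= 1 /\ 0 <= x2 <= 1].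
  move=> /andP[v1 v2].
  have [|x1 x1ab fx1] := IVT_continuous a b v (ltW ab); first by rewrite !ltW.
  have [|x2 x2bc fx2] := IVT_continuous b c v (ltW bc).
    by rewrite -fac minC maxC !ltW.
  have x1b : x1 != b.
    apply/eqP => x1b; move: v1 v2; rewrite -fx1 x1b gt_min lt_max ltxx !orbF.
    by case: ltgtP.
  exists x1, x2; split => //.
  - apply: contra_neq x1b => x12; apply/eqP; rewrite eq_le.
    by move: x1ab x2bc; rewrite -x12 => /andP[_ ->] /andP[->].
  - rewrite /ball/= ![`|x0 - _|]distrC !ltr_distl; move: ax cx x1ab x2bc.
    by rewrite !ltr_distl; lra.
  - by move: a0 c1 x1ab x2bc; lra.
have [v Vv] : V !=set0.
  exists ((f a + f b) / 2); rewrite /V/=; case: (ltgtP (f a) (f b)) fba => // h _; lra.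
have [x1 [_ [_ [fx1 _] [bx1 _] [x11 _]]]] := twice v Vv.
have vr : takagi_range f v by exists x1 => //=; rewrite in_itv.
pose z : takagi_range f := SigSub (mem_set vr).
have Uz : U z.
  by rewrite -WU /preimage/= set_valE/= -fx1; have [] := eW _ bx1.
have [z' [[x' x'E] Vz']] : unique_in_ball p q `&` (set_val @^-1` V) !=set0.
  apply: (Ucl z Uz); apply: open_nbhs_nbhs; split; first by exists V.
  by rewrite /preimage/= set_valE.
have [u1 [u2 [/eqP u12 [fu1 fu2] [bu1 bu2] [u11 u21]]]] := twice _ Vz'.
apply: u12; transitivity x'.
  suff : [set x'] u1 by [].
  by rewrite -x'E; split; [split => //=; rewrite in_itv|have [] := eW _ bu1].
suff : [set x'] u2 by [].
by rewrite -x'E; split; [split => //=; rewrite in_itv|have [] := eW _ bu2].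
Qed.

Lemma not_perfect_levelP (y : takagi_range f) :
  ~ perfect_levels f (set_val y) <->
  exists p q : rat, unique_in_ball (ratr p : R) (ratr q) y.
Proof.
split=> [np|[p [q [x xE]]] [_ /perfectP[_ iso]]].
- have L0 : level_set f (set_val y) !=set0.
    by have [x x01 fx] := set_valP y; exists x.
  have [x [xL [V xV VL]]] : isolated (level_set f (set_val y)) !=set0.
    apply/set0P/eqP => iso; apply: np; split => //; apply/perfectP; split => //.
    exact: level_set_closed.
  have [p [q [xB BV]]] := rational_ball _ _ _ xV.
  exists p, q, x; apply/seteqP; split => [z [zL /BV zV]|_ ->].
    by rewrite -VL.
  by split => //; exact: set_mem.
- have [xL xB] : (level_set f (set_val y) `&` ball (ratr p : R) (ratr q)) x by rewrite xE.
  suff : isolated (level_set f (set_val y)) x by rewrite iso.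
  split; first exact: mem_set.
  exists (ball (ratr p : R) (ratr q)); last by rewrite setIC.
  by apply: open_nbhs_nbhs; split => //; exact: ball_open.
Qed.

(** Nonperfect levels are covered by the countably many sets attached to
    rational balls. *)
Lemma perfect_levels_residual :
  (forall x, 0 <= x <= 1 -> returns_near R f x) ->
  residual_in (takagi_range f) (perfect_levels f).
Proof.
move=> ret.
pose F (n : nat) : set (takagi_range f) :=
  if unpickle n is Some (p, q) then unique_in_ball (ratr p : R) (ratr q) else set0.
exists F => [n|].
  rewrite /F; case: unpickle => [[p q]|]; first exact: unique_in_ball_nowhere_dense.
  by rewrite /nowhere_dense closure0 interior0.
apply/seteqP; split => [y /not_perfect_levelP[p [q ypq]]|y [n _ +]].
  exists (pickle (p, q)); first exact: I.
  by rewrite /F pickleK; exact: ypq.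
rewrite /F; case: unpickle => [[p q]|//] ypq.
by apply/not_perfect_levelP; exists p, q.
Qed.

Lemma perfect_level_uncountable y :
  perfect_levels f y -> ~ countable (level_set f y).
Proof.
move=> [L0 pL]; apply: (perfect_compact_uncountable _ (level_set f y)) => //.
- by move=> x A; exact: uniform_regular.
- exact: level_set_compact.
Qed.

End LevelSets.

Theorem theorem1p3 (R : realType) (f : R -> R) (hf : signed_takagi f) :
  residual_in (takagi_range f) (perfect_levels f) /\
  (forall y : R, perfect_levels f y -> ~ countable (level_set f y)).
Proof.
have [r r_sign fE] := hf.
have -> : f = takagi R r by apply/funext.
have tc := takagi_continuous R r r_sign.
split=> [|y]; last exact: perfect_level_uncountable.
by apply: perfect_levels_residual => // x; exact: takagi_returns.
Qed.
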